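(* Let $X$ be a complex Banach space and let $(U_k)_{k\ge1}$, $(V_k)_{k\ge1}$ be sequences in $\mathcal L(X)$ with $$\sup_n\sup_{\epsilon_k=\pm1}\Big\|\sum_{k=1}^n\epsilon_kU_k\Big\|\le M<\infty,\qquad \sup_n\sup_{\epsilon_k=\pm1}\Big\|\sum_{k=1}^n\epsilon_kV_k\Big\|\le M.$$ Let $\mathcal F\subset\mathcal L(X)$ be a family of operators which commutes with each $U_k$ and each $V_k$ and is R-bounded with constant $R$. Then: (1) the sequence $(U_n)_{n\ge1}$ is R-bounded with constant $M$; (2) if $X$ has property $(\alpha)$, the collection $\{\sum_{k=1}^n\alpha_kT_kU_kV_k:\ n\in\mathbb N,\ |\alpha_k|\le1,\ T_k\in\mathcal F\}$ is R-bounded with constant $CRM^2$, where $C$ depends only on $X$; in particular $\{\sum_{k=1}^n\alpha_kU_kV_k:\ n\in\mathbb N,\ |\alpha_1|,\dots,|\alpha_n|\le1\}$ is R-bounded with constant $CM^2$, $C$ depending only on $X$; (3) if $X$ has property (A), the family $\{\sum_{k=1}^n\alpha_kU_kV_k:\ n\in\mathbb N,\ |\alpha_1|,\dots,|\alpha_n|\le1\}$ is WR-bounded with constant $CM^2$, where $C$ depends only on $X$; (4) if $X$ has property $(\Delta)$, the set $\{\sum_{k=1}^nU_kV_k:\ n\in\mathbb N\}$ is R-bounded with constant $CM^2$, where $C$ depends only on $X$.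
   Context: Let $(\epsilon_k)$ and $(\eta_k)$ be two mutually independent sequences of independent Rademacher variables, with expectation $\mathbb E$. A family $\mathcal F\subset\mathcal L(X)$ is R-bounded with constant $C$ if for all $n$, $x_1,\dots,x_n\in X$ and $T_1,\dots,T_n\in\mathcal F$: $(\mathbb E\|\sum_{k=1}^n\epsilon_kT_kx_k\|^2)^{1/2}\le C(\mathbb E\|\sum_{k=1}^n\epsilon_kx_k\|^2)^{1/2}$. It is WR-bounded with constant $C$ if for all $n$, $x_k\in X$, $x_k^*\in X^*$, $T_k\in\mathcal F$: $\sum_{k=1}^n|\langle T_kx_k,x_k^*\rangle|\le C(\mathbb E\|\sum_k\epsilon_kx_k\|^2)^{1/2}(\mathbb E\|\sum_k\epsilon_kx_k^*\|^2)^{1/2}$. $X$ has property $(\alpha)$ if there is $C$ with $(\mathbb E\|\sum_{j,k=1}^n\alpha_{jk}\epsilon_j\eta_kx_{jk}\|^2)^{1/2}\le C\max_{j,k}|\alpha_{jk}|\,(\mathbb E\|\sum_{j,k=1}^n\epsilon_j\eta_kx_{jk}\|^2)^{1/2}$ for all $n$, $x_{jk}\in X$, $\alpha_{jk}\in\mathbb C$. $X$ has property (A) if there is $C$ with $\sum_{j,k=1}^n|\langle x_{jk},x_{jk}^*\rangle|\le C(\mathbb E\|\sum_{j,k}\epsilon_j\eta_kx_{jk}\|^2)^{1/2}(\mathbb E\|\sum_{j,k}\epsilon_j\eta_kx^*_{jk}\|^2)^{1/2}$ for all $n$, $x_{jk}\in X$, $x^*_{jk}\in X^*$. $X$ has property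 $(\Delta)$ if there is $C$ with $(\mathbb E\|\sum_{j=1}^n\sum_{k=1}^j\epsilon_j\eta_kx_{jk}\|^2)^{1/2}\le C(\mathbb E\|\sum_{j,k=1}^n\epsilon_j\eta_kx_{jk}\|^2)^{1/2}$ for all $n$ and $x_{jk}\in X$. *)

(* Defs.v *)
From mathcomp Require Import all_boot all_order all_algebra.
From mathcomp Require Import all_classical all_reals all_analysis.
From mathcomp Require Export complex.
Export Order.TTheory GRing.Theory Num.Theory.

Set Implicit Arguments.
Unset Strict Implicit.
Unset Printing Implicit Defensive.

Local Open Scope ring_scope.
Local Open Scope classical_set_scope.

Section RadDefs.
Variable R : realType.
Local Notation C := (R[i]).

Definition cabs (z : C) : R := complex.Re `|z|.

Definition sgn n (s : {ffun 'I_n -> bool}) (k : 'I_n) : C :=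
  if s k then 1 else -1.

(* E || f(eps) ||^2 for one Rademacher sequence eps_1..eps_n
   (uniform average over all 2^n sign vectors). *)
Definition rad_avg (V : Type) (N : V -> R) n (f : ('I_n -> C) -> V) : R :=
  (2 ^+ n)^-1 * \sum_(s : {ffun 'I_n -> bool}) (N (f (sgn s))) ^+ 2.

Definition rad_avg2 (V : Type) (N : V -> R) n
    (f : ('I_n -> C) -> ('I_n -> C) -> V) : R :=
  (4 ^+ n)^-1 * \sum_(s : {ffun 'I_n -> bool}) \sum_(t : {ffun 'I_n -> bool})
      (N (f (sgn s) (sgn t))) ^+ 2.

Variable X : normedModType C.

Definition nrm (x : X) : R := complex.Re `|x|.

Definition is_bop (T : X -> X) : Prop :=
  (forall (a : C) (x y : X), T (a *: x + y) = a *: T x + T y) /\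
  exists c : R, forall x, nrm (T x) <= c * nrm x.

Definition is_dual (f : X -> C) : Prop :=
  (forall (a : C) (x y : X), f (a *: x + y) = a * f x + f y) /\
  exists c : R, forall x, cabs (f x) <= c * nrm x.

Definition dnorm (f : X -> C) : R :=
  sup [set cabs (f x) | x in [set x : X | nrm x <= 1]].

Definition Rbounded (F : set (X -> X)) (K : R) : Prop :=
  forall n (T : 'I_n -> X -> X) (x : 'I_n -> X), (forall k, F (T k)) ->
    Num.sqrt (rad_avg nrm (fun e => \sum_(k < n) e k *: T k (x k)))
    <= K * Num.sqrt (rad_avg nrm (fun e => \sum_(k < n) e k *: x k)).

Definition WRbounded (F : set (X -> X)) (K : R) : Prop :=
  forall n (T : 'I_n -> X -> X) (x : 'I_n -> X) (xs : 'I_n -> X -> C),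
    (forall k, F (T k)) -> (forall k, is_dual (xs k)) ->
    \sum_(k < n) cabs (xs k (T k (x k)))
    <= K * Num.sqrt (rad_avg nrm (fun e => \sum_(k < n) e k *: x k))
         * Num.sqrt (rad_avg dnorm (fun e => fun y => \sum_(k < n) e k * xs k y)).

Definition prop_alpha : Prop :=
  exists K : R, forall n (x : 'I_n -> 'I_n -> X) (a : 'I_n -> 'I_n -> C),
    Num.sqrt (rad_avg2 nrm (fun e h =>
       \sum_(j < n) \sum_(k < n) (a j k * e j * h k) *: x j k))
    <= K * (\big[Num.max/0]_(j < n) \big[Num.max/0]_(k < n) cabs (a j k))
         * Num.sqrt (rad_avg2 nrm (fun e h =>
             \sum_(j < n) \sum_(k < n) (e j * h k) *: x j k)).

Definition prop_A : Prop :=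
  exists K : R, forall n (x : 'I_n -> 'I_n -> X) (xs : 'I_n -> 'I_n -> X -> C),
    (forall j k, is_dual (xs j k)) ->
    \sum_(j < n) \sum_(k < n) cabs (xs j k (x j k))
    <= K * Num.sqrt (rad_avg2 nrm (fun e h =>
             \sum_(j < n) \sum_(k < n) (e j * h k) *: x j k))
         * Num.sqrt (rad_avg2 dnorm (fun e h => fun y =>
             \sum_(j < n) \sum_(k < n) e j * h k * xs j k y)).

Definition prop_Delta : Prop :=
  exists K : R, forall n (x : 'I_n -> 'I_n -> X),
    Num.sqrt (rad_avg2 nrm (fun e h =>
       \sum_(j < n) \sum_(k < n | (k <= j)%N) (e j * h k) *: x j k))
    <= K * Num.sqrt (rad_avg2 nrm (fun e h =>
             \sum_(j < n) \sum_(k < n) (e j * h k) *: x j k)).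

Definition sign_sum_bounded (U : nat -> X -> X) (M : R) : Prop :=
  forall n (s : {ffun 'I_n -> bool}) (x : X),
    nrm (\sum_(k < n) sgn s k *: U k x) <= M * nrm x.

Definition thm33_hyps (U V : nat -> X -> X) (M : R) (F : set (X -> X)) (Rc : R)
  : Prop :=
  (forall k, is_bop (U k)) /\ (forall k, is_bop (V k)) /\
  sign_sum_bounded U M /\ sign_sum_bounded V M /\
  (forall T, F T -> is_bop T) /\
  (forall T, F T -> forall k x, T (U k x) = U k (T x)) /\
  (forall T, F T -> forall k x, T (V k x) = V k (T x)) /\
  Rbounded F Rc.

(* { sum_{k<=n} alpha_k T_k U_k V_k : n, |alpha_k| <= 1, T_k in F }
   (0-based indices: k ranges over 0..n) *)
Definition fam_TUV (U V : nat -> X -> X) (F : set (X -> X)) : set (X -> X) :=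
  [set S | exists n (a : 'I_n.+1 -> C) (T : 'I_n.+1 -> X -> X),
     (forall k, cabs (a k) <= 1) /\ (forall k, F (T k)) /\
     S = (fun x => \sum_(k < n.+1) a k *: T k (U k (V k x)))].

Definition fam_UV (U V : nat -> X -> X) : set (X -> X) :=
  [set S | exists n (a : 'I_n.+1 -> C),
     (forall k, cabs (a k) <= 1) /\
     S = (fun x => \sum_(k < n.+1) a k *: U k (V k x))].

Definition fam_sumUV (U V : nat -> X -> X) : set (X -> X) :=
  [set S | exists n, S = (fun x => \sum_(k < n.+1) U k (V k x))].

End RadDefs.

(* Main.v *)
(* For signs [t] averaged uniformly, [\sum_k U_k y_k] is the mean of
   [(\sum_k t_k U_k) (\sum_k t_k y_k)], so the bound [M] on signed sums of the [U_k]
   controls its norm by [M] times the quadratic mean of [\sum_k t_k y_k].  Commuting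
   [U_k] to the left in [\sum_i s_i S_i x_i] thus produces double random sums in
   [s_i t_k V_k x_i].  The property of [X] at hand removes the scalars, the operators
   or the triangular truncation, and the remaining sum is
   [(\sum_k t_k V_k) (\sum_i s_i x_i)], which costs a second factor [M]. *)
Require Import Defs.
From mathcomp Require Import all_boot all_order all_algebra.
From mathcomp Require Import all_classical all_reals all_analysis.
From mathcomp Require Import complex ring.
Import Order.TTheory GRing.Theory Num.Theory.
Local Open Scope ring_scope.
Local Open Scope classical_set_scope.
Set Implicit Arguments.
Unset Strict Implicit.

(** * Uniform averages over sign vectors *)

Definition avg (R : realType) (I : finType) (g : {ffun I -> bool} -> R) : R :=
  (2 ^+ #|I|)^-1 * \sum_(s : {ffun I -> bool}) g s.

(* The product of two sign vectors, [true] standing for [1] and [false] for [-1]. *)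
Definition signM (I : finType) (s t : {ffun I -> bool}) : {ffun I -> bool} :=
  [ffun i => s i == t i].

Section Average.
Variables (R : realType).

Lemma avg_le (I : finType) (g h : {ffun I -> bool} -> R) :
  (forall s, g s <= h s) -> avg g <= avg h.
Proof.
by move=> gh; rewrite ler_wpM2l ?invr_ge0 ?exprn_ge0// ler_sum.
Qed.

Lemma avg_cst (I : finType) (c : R) : avg (fun _ : {ffun I -> bool} => c) = c.
Proof.
rewrite /avg sumr_const card_ffun card_bool -[c *+ _]mulr_natl natrX mulKf//.
Qed.

Lemma avgZ (I : finType) (c : R) (g : {ffun I -> bool} -> R) :
  avg (fun s => c * g s) = c * avg g.
Proof. by rewrite /avg -mulr_sumr mulrCA. Qed.

Lemma avg_swap (I J : finType) (g : {ffun I -> bool} -> {ffun J -> bool} -> R) :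
  avg (fun s => avg (g s)) = avg (fun t => avg (g^~ t)).
Proof.
rewrite /avg; under eq_bigr do rewrite mulr_sumr.
under [in RHS]eq_bigr do rewrite mulr_sumr.
rewrite exchange_big/= !mulr_sumr; apply: eq_bigr => t _.
by rewrite !mulr_sumr; apply: eq_bigr => s _; rewrite mulrCA.
Qed.

Lemma signMK (I : finType) (t : {ffun I -> bool}) : involutive (fun s => signM s t).
Proof. by move=> s; apply/ffunP => i; rewrite !ffunE; case: (s i) (t i) => [] []. Qed.

(** Multiplication by a fixed sign vector is an involution, so the Rademacher law is invariant under
    it. Every absorption of auxiliary signs below rests on this. *)
Lemma avg_shift (I : finType) (t : {ffun I -> bool}) (g : {ffun I -> bool} -> R) :
  avg (fun s => g (signM s t)) = avg g.
Proof.
by rewrite /avg [in RHS](reindex_inj (inv_inj (signMK t))).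
Qed.

Lemma eq_avg (I : finType) (g h : {ffun I -> bool} -> R) : g =1 h -> avg g = avg h.
Proof. by move=> gh; congr (_ * _); apply: eq_bigr => s _; rewrite gh. Qed.

(* Multiplying [s] by an independent random sign vector carried by the range
   of [f] leaves its law unchanged and makes [s \o f] uniform. *)
Lemma avg_inj (I K : finType) (f : I -> K) (g : {ffun I -> bool} -> R) :
  injective f -> avg (fun s : {ffun K -> bool} => g [ffun i => s (f i)]) = avg g.
Proof.
move=> f_inj.
have [ext extE] : exists ext : {ffun I -> bool} -> {ffun K -> bool},
    forall t i, ext t (f i) = t i.
  exists (fun t => [ffun k => if [pick i | f i == k] is Some i then t i else true]).
  move=> t i; rewrite ffunE; case: pickP => [j /eqP/f_inj->//|/(_ i)].
  by rewrite eqxx.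
rewrite -[LHS](avg_cst I).
under eq_avg => t do rewrite -(avg_shift (ext t)).
rewrite avg_swap -[RHS](avg_cst K); apply: eq_avg => s.
rewrite -[RHS](avg_shift [ffun i => s (f i)]); apply: eq_avg => t.
by congr g; apply/ffunP => i; rewrite !ffunE extE eq_sym.
Qed.

Lemma avg_ge0 (I : finType) (g : {ffun I -> bool} -> R) :
  (forall s, 0 <= g s) -> 0 <= avg g.
Proof. by move=> g0; rewrite -(avg_cst I 0) avg_le. Qed.

(** The variance [avg (fun s => (g s - avg g) ^+ 2)] is nonnegative. *)
Lemma avg_sqr_le (I : finType) (g : {ffun I -> bool} -> R) :
  avg g ^+ 2 <= avg (fun s => g s ^+ 2).
Proof.
have : 0 <= avg (fun s => (g s - avg g) ^+ 2) by apply: avg_ge0 => s; rewrite sqr_ge0.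
set m := avg g.
have -> : avg (fun s => (g s - m) ^+ 2) = avg (fun s => g s ^+ 2) - m ^+ 2.
  transitivity (avg (fun s => g s ^+ 2) - 2 * m * avg g + avg (fun _ : {ffun I -> bool} => m ^+ 2)).
    rewrite -avgZ /avg -mulrBr -mulrDr -sumrB -big_split/=.
    congr (_ * _); apply: eq_bigr => s _.
    by ring.
  by rewrite avg_cst -/m; ring.
by rewrite subr_ge0.
Qed.

End Average.

(** * Real-valued norm and modulus, and scalar signs *)

Section Norm.
Variables (R : realType) (X : normedModType R[i]).
Local Notation C := R[i].
Implicit Types (x y : X) (a b : C).

Lemma nrmE x : (nrm x)%:C%C = `|x|.
Proof. by rewrite /nrm RRe_real ?normr_real. Qed.
Lemma cabsE a : (cabs a)%:C%C = `|a|.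
Proof. by rewrite /cabs RRe_real ?normr_real. Qed.
Lemma nrm_ge0 x : 0 <= nrm x. Proof. rewrite -lecR nrmE; exact: normr_ge0. Qed.
Lemma cabs_ge0 a : 0 <= cabs a. Proof. rewrite -lecR cabsE; exact: normr_ge0. Qed.
Lemma nrmZ a x : nrm (a *: x) = cabs a * nrm x.
Proof. by apply: (@complexI R); rewrite rmorphM/= !nrmE cabsE normrZ. Qed.
Lemma cabsM a b : cabs (a * b) = cabs a * cabs b.
Proof. by apply: (@complexI R); rewrite rmorphM/= !cabsE normrM. Qed.
Lemma nrmD x y : nrm (x + y) <= nrm x + nrm y.
Proof. by rewrite -lecR rmorphD/= !nrmE ler_normD. Qed.
Lemma cabsD a b : cabs (a + b) <= cabs a + cabs b.
Proof. by rewrite -lecR rmorphD/= !cabsE ler_normD. Qed.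
Lemma nrm0 : nrm (0 : X) = 0. Proof. by rewrite /nrm normr0. Qed.
Lemma cabs0 : cabs (0 : C) = 0. Proof. by rewrite /cabs normr0. Qed.
Lemma nrm_sum (I : finType) (f : I -> X) : nrm (\sum_i f i) <= \sum_i nrm (f i).
Proof.
elim/big_ind2: _ => [|? ? ? ? h1 h2|//]; first by rewrite nrm0.
by rewrite (le_trans (nrmD _ _))// lerD.
Qed.
Lemma cabs_sum (I : finType) (f : I -> C) : cabs (\sum_i f i) <= \sum_i cabs (f i).
Proof.
elim/big_ind2: _ => [|? ? ? ? h1 h2|//]; first by rewrite cabs0.
by rewrite (le_trans (cabsD _ _))// lerD.
Qed.
End Norm.

(** [sg (s k)] is convertible to [sgn s k], but leaves the index type of [s] free. *)
Definition sg (R : realType) (b : bool) : R[i] := if b then 1 else -1.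
Arguments sg {R} b.

Section Sign.
Variables (R : realType).
Lemma cabs_sg b : cabs (sg b : R[i]) = 1.
Proof. by case: b; rewrite /cabs ?normrN normr1. Qed.
Lemma sgM b c : sg (b == c) = sg b * sg c :> R[i].
Proof. by case: b c => [] []; rewrite /= ?mulrN ?mulNr ?mulr1 ?mul1r ?opprK. Qed.
Lemma sg_sqr b : sg b * sg b = 1 :> R[i].
Proof. by rewrite -sgM eqxx. Qed.

Lemma sg_orthogonal (I : finType) (i j : I) :
  \sum_(s : {ffun I -> bool}) sg (s i) * sg (s j) = (if i == j then 2 ^+ #|I| else 0) :> R[i].
Proof.
case: eqVneq => [->|ij].
  by under eq_bigr do rewrite sg_sqr; rewrite sumr_const card_ffun card_bool -natrX.
set S := \sum_s _; suff : S *+ 2 = 0 by move/eqP; rewrite mulrn_eq0 => /eqP.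
apply/eqP; rewrite mulr2n addr_eq0; apply/eqP.
(* Flipping the sign at [i] alone is a bijection of the sign vectors that negates each summand, so
   [S = - S]. *)
rewrite {1}/S (reindex_inj (inv_inj (signMK [ffun k => k != i]))) -sumrN/=.
apply: eq_bigr => s _; rewrite !ffunE eqxx (eq_sym j i) ij !sgM/=.
by ring.
Qed.
End Sign.

(** * Linear maps and finite sums regrouped along fibres *)

Section Linear.
Variables (K : pzRingType) (V W : lmodType K) (T : V -> W).
Hypothesis Tlin : forall a x y, T (a *: x + y) = a *: T x + T y.

Lemma lin0 : T 0 = 0.
Proof.
by apply: (addIr (T 0)); rewrite -[X in X + _]scale1r -Tlin scale1r !add0r.
Qed.

Lemma linD x y : T (x + y) = T x + T y.
Proof. by rewrite -[x]scale1r Tlin !scale1r. Qed.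

Lemma linZ a x : T (a *: x) = a *: T x.
Proof. by rewrite -[a *: x]addr0 Tlin lin0 addr0. Qed.

Lemma lin_sum (I : finType) (P : pred I) (x : I -> V) :
  T (\sum_(i | P i) x i) = \sum_(i | P i) T (x i).
Proof. by apply: big_morph; [exact: linD | exact: lin0]. Qed.

Lemma lin_sumZ (I : finType) (P : pred I) (a : I -> K) (x : I -> V) :
  T (\sum_(i | P i) a i *: x i) = \sum_(i | P i) a i *: T (x i).
Proof. by rewrite lin_sum; apply: eq_bigr => i _; rewrite linZ. Qed.
End Linear.

Section Embedding.

Lemma sum_fibre (K : pzSemiRingType) (V : lSemiModType K) (I J : finType) (f : I -> J)
    (c : J -> K) (x : I -> V) :
  \sum_j c j *: (\sum_(i | f i == j) x i) = \sum_i c (f i) *: x i.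
Proof.
rewrite [RHS](partition_big f predT)//=; apply: eq_bigr => j _.
by rewrite scaler_sumr; apply: eq_bigr => i /eqP ->.
Qed.

Lemma sum_fibre_inj (V : nmodType) (I J : finType) (f : I -> J) (x : I -> V) i0 :
  injective f -> \sum_(i | f i == f i0) x i = x i0.
Proof.
by move=> f_inj; rewrite (big_pred1 i0)// => i; rewrite /= (inj_eq f_inj).
Qed.

Lemma sum_comp_inj_le (R : numDomainType) (I J : finType) (f : I -> J) (F : J -> R) :
  injective f -> (forall j, 0 <= F j) -> \sum_i F (f i) <= \sum_j F j.
Proof.
move=> f_inj F0; rewrite (partition_big f predT)//=; apply: ler_sum => j _.
case: (pickP (fun i => f i == j)) => [i0 /eqP fi0|none]; last by rewrite big_pred0.
by rewrite -fi0 (sum_fibre_inj (fun i => F (f i))).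
Qed.

(** The push-forward of the array [x] along [f] and [g]. For injective [f] and [g] it is [x]
    extended by zero to the square [L * L]. *)
Definition block (V : nmodType) (I J L : finType) (f : I -> L) (g : J -> L)
    (x : I -> J -> V) (k l : L) : V :=
  \sum_(i | f i == k) \sum_(j | g j == l) x i j.

Lemma blockE (V : nmodType) (I J L : finType) (f : I -> L) (g : J -> L)
    (x : I -> J -> V) i j :
  injective f -> injective g -> block f g x (f i) (g j) = x i j.
Proof. by move=> fI gI; rewrite /block sum_fibre_inj// sum_fibre_inj. Qed.

Lemma sum_block (K : pzSemiRingType) (V : lSemiModType K) (I J L : finType) (f : I -> L)
    (g : J -> L) (c : L -> L -> K) (x : I -> J -> V) :
  \sum_k \sum_l c k l *: block f g x k l = \sum_i \sum_j c (f i) (g j) *: x i j.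
Proof.
rewrite [RHS](partition_big f predT)//=; apply: eq_bigr => k _.
under eq_bigr => l _ do rewrite scaler_sumr.
rewrite exchange_big/=; apply: eq_bigr => i /eqP ->.
exact: sum_fibre.
Qed.

End Embedding.

(** * Double averages, and passage between root and squared inequalities *)

Section Averages.
Variable R : realType.

Lemma avg2_inj (I J K L : finType) (f : I -> K) (g : J -> L)
    (h : {ffun I -> bool} -> {ffun J -> bool} -> R) :
  injective f -> injective g ->
  avg (fun s : {ffun K -> bool} => avg (fun t : {ffun L -> bool} =>
    h [ffun i => s (f i)] [ffun j => t (g j)])) = avg (fun s => avg (h s)).
Proof.
move=> fI gI; rewrite -(avg_inj _ fI); apply: eq_avg => s.
by rewrite -(avg_inj _ gI).
Qed.

Lemma eq_avg2 (I J : finType) (g h : {ffun I -> bool} -> {ffun J -> bool} -> R) :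
  (forall s t, g s t = h s t) -> avg (fun s => avg (g s)) = avg (fun s => avg (h s)).
Proof. by move=> gh; apply: eq_avg => s; apply: eq_avg => t. Qed.

Lemma rad_avgE (V : Type) (N : V -> R) n (f : ('I_n -> R[i]) -> V) :
  rad_avg N f = avg (fun s => N (f (sgn R s)) ^+ 2).
Proof. by rewrite /rad_avg /avg card_ord. Qed.

Lemma rad_avg2E (V : Type) (N : V -> R) n (f : ('I_n -> R[i]) -> ('I_n -> R[i]) -> V) :
  rad_avg2 N f = avg (fun s => avg (fun t => N (f (sgn R s) (sgn R t)) ^+ 2)).
Proof.
rewrite /rad_avg2 /avg card_ord -mulr_sumr mulrA -invfM -exprMn.
by rewrite -natrM.
Qed.

(** [K * Num.sqrt b] dominates a square root and so is nonnegative whatever the sign of [K]; hence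
    squaring keeps the inequality. *)
Lemma sqrt_le_sqr (a b K : R) :
  0 <= a -> 0 <= b -> Num.sqrt a <= K * Num.sqrt b -> a <= K ^+ 2 * b.
Proof.
move=> a0 b0 ab; rewrite -(sqr_sqrtr a0) -(sqr_sqrtr b0) -exprMn.
by rewrite lerXn2r// ?nnegrE ?sqrtr_ge0// (le_trans _ ab) ?sqrtr_ge0.
Qed.

Lemma sqrt_le_of_sqr (a b K : R) :
  0 <= K -> a <= K ^+ 2 * b -> Num.sqrt a <= K * Num.sqrt b.
Proof.
move=> K0 ab; rewrite -[K in K * _](ger0_norm K0) -sqrtr_sqr -sqrtrM ?sqr_ge0//.
exact: ler_wsqrtr.
Qed.

End Averages.

(** * Operator sequences with bounded signed sums *)

Section SignBounded.
Variables (R : realType) (X : normedModType R[i]).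

Definition sign_bounded (I : finType) (U : I -> X -> X) (M : R) : Prop :=
  forall (s : {ffun I -> bool}) (x : X),
    nrm (\sum_i sg (s i) *: U i x) <= M * nrm x.

(* By orthogonality of the signs, [\sum_i U i (y i)] is the average over [s] of
   [(\sum_i s_i U_i) (\sum_i s_i y_i)]. *)
Lemma sign_bounded_decouple (I : finType) (U : I -> X -> X) (M : R) (y : I -> X) :
  (forall i a x z, U i (a *: x + z) = a *: U i x + U i z) -> sign_bounded U M ->
  nrm (\sum_i U i (y i)) ^+ 2
    <= M ^+ 2 * avg (fun s : {ffun I -> bool} => nrm (\sum_i sg (s i) *: y i) ^+ 2).
Proof.
move=> Ulin UM; set z := \sum_i _.
pose g (s : {ffun I -> bool}) := nrm (\sum_i sg (s i) *: U i (\sum_j sg (s j) *: y j)).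
have zE : (2 ^+ #|I|) *: z =
    \sum_(s : {ffun I -> bool}) \sum_i sg (s i) *: U i (\sum_j sg (s j) *: y j).
  rewrite exchange_big scaler_sumr; apply: eq_bigr => i _.
  under eq_bigr => s _.
    rewrite (lin_sumZ (Ulin i)) scaler_sumr.
    under eq_bigr => j _ do rewrite scalerA.
    over.
  rewrite exchange_big/=; under eq_bigr => j _ do rewrite -scaler_suml sg_orthogonal.
  by rewrite (bigD1 i)//= eqxx big1 ?addr0// => j; rewrite eq_sym => /negPf ->; rewrite scale0r.
(* The triangle inequality bounds [nrm z] by a mean; [avg_sqr_le] then passes to the quadratic mean,
   where [UM] applies for each [s]. *)
have zg : nrm z <= avg g.
  rewrite /avg mulrC ler_pdivlMr ?exprn_gt0// mulrC.
  have -> : 2 ^+ #|I| * nrm z = nrm (2 ^+ #|I| *: z).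
    rewrite nrmZ; congr (_ * _); apply: (@complexI R); rewrite cabsE.
    by rewrite ger0_norm ?exprn_ge0// rmorphXn/= rmorph_nat.
  by rewrite zE; apply: nrm_sum.
have g0 s : 0 <= g s by exact: nrm_ge0.
apply: (@le_trans _ _ (avg g ^+ 2)); first by rewrite lerXn2r ?nnegrE ?nrm_ge0 ?avg_ge0.
apply: (le_trans (avg_sqr_le _)); rewrite -avgZ; apply: avg_le => s.
rewrite -exprMn; have gM : g s <= M * nrm (\sum_i sg (s i) *: y i) by exact: (UM s).
by rewrite lerXn2r ?nnegrE// (le_trans (g0 s) gM).
Qed.

Lemma sign_bounded_sqr (I : finType) (U : I -> X -> X) (M : R) (s : {ffun I -> bool}) x :
  sign_bounded U M -> nrm (\sum_i sg (s i) *: U i x) ^+ 2 <= M ^+ 2 * nrm x ^+ 2.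
Proof.
move=> UM; rewrite -exprMn lerXn2r ?nnegrE ?nrm_ge0// ?UM//.
by rewrite (le_trans _ (UM s x))// nrm_ge0.
Qed.

(** Brings the double sum into the form that [sign_bounded_sqr] bounds for each fixed choice of
    signs. *)
Lemma sum_sign_bounded (I J : finType) (V : J -> X -> X) (e : I -> R[i]) (h : J -> R[i])
    (x : I -> X) :
  (forall j a x z, V j (a *: x + z) = a *: V j x + V j z) ->
  \sum_i \sum_j (e i * h j) *: V j (x i) = \sum_j h j *: V j (\sum_i e i *: x i).
Proof.
move=> Vlin; rewrite exchange_big; apply: eq_bigr => j _.
rewrite (lin_sumZ (Vlin j)) scaler_sumr; apply: eq_bigr => i _.
by rewrite scalerA mulrC.
Qed.

End SignBounded.

(** * The properties of [X] for arbitrary finite index sets, and R-boundedness in squared form *)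

Section Properties.
Variables (R : realType) (X : normedModType R[i]).
Local Notation C := R[i].

(* Both index sets are embedded in [I + J], because the properties only speak
   of square arrays. *)
Section Square.
Variables (I J : finType).
Local Notation m := #|{: I + J}|.
Let f (i : I) : 'I_m := enum_rank (inl i : I + J).
Let g (j : J) : 'I_m := enum_rank (inr j : I + J).
Let fI : injective f. Proof. by move=> i i' /enum_rank_inj []. Qed.
Let gI : injective g. Proof. by move=> j j' /enum_rank_inj []. Qed.

(** Only the entries over the images of [f] and [g] contribute, and uniform signs on ['I_m] restrict
    to uniform signs on [I] and on [J]. *)
Lemma avg_block (Y : lmodType C) (N : Y -> R) (a : I -> J -> C) (b : 'I_m -> 'I_m -> C)
    (x : I -> J -> Y) :
  (forall i j, b (f i) (g j) = a i j) ->
  rad_avg2 N (fun e h => \sum_k \sum_l (b k l * e k * h l) *: block f g x k l) =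
  avg (fun s => avg (fun t => N (\sum_i \sum_j (a i j * sg (s i) * sg (t j)) *: x i j) ^+ 2)).
Proof.
move=> ba; rewrite rad_avg2E -[RHS](avg2_inj _ fI gI).
apply: eq_avg2 => s t; congr (N _ ^+ 2).
rewrite (sum_block _ _ (fun k l => b k l * sgn R s k * sgn R t l)).
by apply: eq_bigr => i _; apply: eq_bigr => j _; rewrite !ffunE ba.
Qed.

Lemma avg_block1 (Y : lmodType C) (N : Y -> R) (x : I -> J -> Y) :
  rad_avg2 N (fun e h => \sum_k \sum_l (e k * h l) *: block f g x k l) =
  avg (fun s => avg (fun t => N (\sum_i \sum_j (sg (s i) * sg (t j)) *: x i j) ^+ 2)).
Proof.
transitivity (rad_avg2 N (fun e h => \sum_k \sum_l (1 * e k * h l) *: block f g x k l)).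
  rewrite !rad_avg2E; apply: eq_avg2 => s t; congr (N _ ^+ 2).
  by apply: eq_bigr => k _; apply: eq_bigr => l _; rewrite mul1r.
rewrite (@avg_block _ _ (fun _ _ => 1) (fun _ _ => 1))//.
apply: eq_avg2 => s t; congr (N _ ^+ 2).
by apply: eq_bigr => k _; apply: eq_bigr => l _; rewrite mul1r.
Qed.

Lemma extend_coef (a : I -> J -> C) : (forall i j, cabs (a i j) <= 1) ->
  exists b : 'I_m -> 'I_m -> C,
    (forall k l, cabs (b k l) <= 1) /\ forall i j, b (f i) (g j) = a i j.
Proof.
(* The value 0 off the image respects the bound 1; on the image injectivity determines the pair that
   is picked. *)
move=> a1; exists (fun k l => if [pick p : I * J | (f p.1 == k) && (g p.2 == l)]
  is Some p then a p.1 p.2 else 0); split=> [k l|i j].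
  by case: pickP => // _; rewrite cabs0 ler01.
case: pickP => [[i' j']/= /andP[/eqP/fI-> /eqP/gI->]//|/(_ (i, j))].
by rewrite !eqxx.
Qed.

Lemma alpha_estimate_rect (K : R) (x : I -> J -> X) (a : I -> J -> C) :
  (forall n (x : 'I_n -> 'I_n -> X) (a : 'I_n -> 'I_n -> C),
    Num.sqrt (rad_avg2 (@nrm R X) (fun e h =>
       \sum_(j < n) \sum_(k < n) (a j k * e j * h k) *: x j k))
    <= K * (\big[Num.max/0]_(j < n) \big[Num.max/0]_(k < n) cabs (a j k))
         * Num.sqrt (rad_avg2 (@nrm R X) (fun e h =>
             \sum_(j < n) \sum_(k < n) (e j * h k) *: x j k))) ->
  (forall i j, cabs (a i j) <= 1) ->
  avg (fun s => avg (fun t =>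
    nrm (\sum_i \sum_j (a i j * sg (s i) * sg (t j)) *: x i j) ^+ 2)) <=
  K ^+ 2 * avg (fun s => avg (fun t =>
    nrm (\sum_i \sum_j (sg (s i) * sg (t j)) *: x i j) ^+ 2)).
Proof.
move=> HK /extend_coef[b [b1 ba]].
rewrite -(avg_block _ _ ba) -avg_block1 -[K ^+ 2]real_normK ?num_real//.
apply: sqrt_le_sqr; try by rewrite rad_avg2E; do 2!(apply: avg_ge0 => ?); rewrite sqr_ge0.
apply: (le_trans (HK _ _ _)); apply: ler_wpM2r; first exact: sqrtr_ge0.
have max01 n (F : 'I_n -> R) : (forall i, 0 <= F i <= 1) -> 0 <= \big[Num.max/0]_i F i <= 1.
  move=> F01; elim/big_ind: _ => [|u v /andP[u0 u1] /andP[v0 v1]|i _]; rewrite ?lexx ?ler01//.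
  by rewrite le_max u0/= ge_max u1.
have /andP[s0 s1] := max01 _ (fun k : 'I_m => \big[Num.max/0]_(l < m) cabs (b k l))
  (fun k => max01 _ _ (fun l => introT andP (conj (cabs_ge0 (b k l)) (b1 k l)))).
apply: le_trans (ler_norm _) _; rewrite normrM -[leRHS]mulr1.
by rewrite ler_wpM2l// ger0_norm.
Qed.

Lemma A_estimate_rect (K : R) (x : I -> J -> X) (xs : I -> J -> X -> C) :
  (forall n (x : 'I_n -> 'I_n -> X) (xs : 'I_n -> 'I_n -> X -> C),
    (forall j k, is_dual (xs j k)) ->
    \sum_(j < n) \sum_(k < n) cabs (xs j k (x j k))
    <= K * Num.sqrt (rad_avg2 (@nrm R X) (fun e h =>
             \sum_(j < n) \sum_(k < n) (e j * h k) *: x j k))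
         * Num.sqrt (rad_avg2 (@dnorm R X) (fun e h => fun y =>
             \sum_(j < n) \sum_(k < n) e j * h k * xs j k y))) ->
  (forall i j, is_dual (xs i j)) ->
  \sum_i \sum_j cabs (xs i j (x i j)) <=
  K * Num.sqrt (avg (fun s => avg (fun t =>
        nrm (\sum_i \sum_j (sg (s i) * sg (t j)) *: x i j) ^+ 2)))
    * Num.sqrt (avg (fun s => avg (fun t =>
        dnorm (fun y => \sum_i \sum_j sg (s i) * sg (t j) * xs i j y) ^+ 2))).
Proof.
move=> HK xsd.
(* The functionals are extended by zero in the same way as the vectors, pointwise in [y]. *)
pose ys k l y : C := block f g (fun i j => xs i j y) k l.
have ysd k l : is_dual (ys k l).
  split.
    move=> a y z; rewrite /ys /block mulr_sumr -big_split; apply: eq_bigr => i _.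
    rewrite mulr_sumr -big_split; apply: eq_bigr => j _.
    by have [-> _] := xsd i j.
  have /choice[c cP] : forall p : I * J, exists c : R, forall y,
    cabs (xs p.1 p.2 y) <= c * nrm y by move=> p; have [_] := xsd p.1 p.2.
  exists (\sum_(i | f i == k) \sum_(j | g j == l) c (i, j)) => y.
  rewrite mulr_suml /ys /block.
  elim/big_ind2: _ => [|u v u' v' h1 h2|i _]; first by rewrite cabs0.
    by rewrite (le_trans (cabsD _ _))// lerD.
  rewrite mulr_suml.
  elim/big_ind2: _ => [|u v u' v' h1 h2|j _]; first by rewrite cabs0.
    by rewrite (le_trans (cabsD _ _))// lerD.
  exact: (cP (i, j)).
have -> : avg (fun s => avg (fun t =>
    dnorm (fun y => \sum_i \sum_j sg (s i) * sg (t j) * xs i j y) ^+ 2)) =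
  rad_avg2 (@dnorm R X) (fun e h y => \sum_k \sum_l e k * h l * ys k l y).
  rewrite rad_avg2E -[LHS](avg2_inj _ fI gI); apply: eq_avg2 => s t.
  congr (dnorm _ ^+ 2); apply/funext => y; symmetry.
  rewrite (sum_block (V := C^o) _ _ (fun k l => sgn R s k * sgn R t l)).
  by apply: eq_bigr => i _; apply: eq_bigr => j _; rewrite !ffunE.
rewrite -avg_block1; apply: le_trans (HK _ _ _ ysd).
pose F k l := cabs (ys k l (block f g x k l)).
have F0 k l : 0 <= F k l by exact: cabs_ge0.
(* Restricting to the images of [f] and [g] discards only nonnegative terms, and there [blockE]
   gives back the original pairs. *)
apply: le_trans (sum_comp_inj_le (F := fun k => \sum_l F k l) fI _); last first.
  by move=> k; apply: sumr_ge0.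
apply: ler_sum => i _; apply: le_trans (sum_comp_inj_le gI (F0 _)).
by apply: ler_sum => j _; rewrite /F /ys !blockE.
Qed.

End Square.

Lemma prop_alpha_rect : prop_alpha X -> exists K : R, forall (I J : finType)
    (x : I -> J -> X) (a : I -> J -> C), (forall i j, cabs (a i j) <= 1) ->
  avg (fun s => avg (fun t =>
    nrm (\sum_i \sum_j (a i j * sg (s i) * sg (t j)) *: x i j) ^+ 2)) <=
  K ^+ 2 * avg (fun s => avg (fun t =>
    nrm (\sum_i \sum_j (sg (s i) * sg (t j)) *: x i j) ^+ 2)).
Proof. by move=> [K HK]; exists K => I J x a; apply: alpha_estimate_rect. Qed.

Lemma prop_A_rect : prop_A X -> exists2 K : R, 0 <= K & forall (I J : finType)
    (x : I -> J -> X) (xs : I -> J -> X -> C), (forall i j, is_dual (xs i j)) ->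
  \sum_i \sum_j cabs (xs i j (x i j)) <=
  K * Num.sqrt (avg (fun s => avg (fun t =>
        nrm (\sum_i \sum_j (sg (s i) * sg (t j)) *: x i j) ^+ 2)))
    * Num.sqrt (avg (fun s => avg (fun t =>
        dnorm (fun y => \sum_i \sum_j sg (s i) * sg (t j) * xs i j y) ^+ 2))).
Proof.
move=> [K HK]; exists `|K| => // I J x xs xsd.
apply: A_estimate_rect => // n y ys ysd; apply: le_trans (HK n y ys ysd) _.
by rewrite !ler_wpM2r ?sqrtr_ge0 ?ler_norm.
Qed.

Lemma prop_Delta_sqr : prop_Delta X -> exists2 K : R, 0 <= K & forall n (x : 'I_n -> 'I_n -> X),
  avg (fun s => avg (fun t =>
    nrm (\sum_(j < n) \sum_(k < n | (k <= j)%N) (sg (s j) * sg (t k)) *: x j k) ^+ 2)) <=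
  K ^+ 2 * avg (fun s => avg (fun t =>
    nrm (\sum_(j < n) \sum_(k < n) (sg (s j) * sg (t k)) *: x j k) ^+ 2)).
Proof.
move=> [K HK]; exists `|K| => // n x.
apply: sqrt_le_sqr; try by do 2!(apply: avg_ge0 => ?); rewrite sqr_ge0.
have := HK n x; rewrite !rad_avg2E => /le_trans; apply.
by rewrite ler_wpM2r ?sqrtr_ge0 ?ler_norm.
Qed.

(** Allows index sets such as pairs; the enumeration of [I] transports the signs. *)
Lemma Rbounded_fin (F : set (X -> X)) (K : R) (I : finType) (T : I -> X -> X) (x : I -> X) :
  Rbounded F K -> (forall i, F (T i)) ->
  avg (fun s : {ffun I -> bool} => nrm (\sum_i sg (s i) *: T i (x i)) ^+ 2) <=
  K ^+ 2 * avg (fun s : {ffun I -> bool} => nrm (\sum_i sg (s i) *: x i) ^+ 2).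
Proof.
move=> FK FT.
have enumI : injective (@enum_rank I) by exact: enum_rank_inj.
have reenum (y : I -> X) : avg (fun s : {ffun I -> bool} => nrm (\sum_i sg (s i) *: y i) ^+ 2) =
    rad_avg (@nrm R X) (fun e => \sum_(k < #|I|) e k *: y (enum_val k)).
  rewrite rad_avgE -(avg_inj _ enumI); apply: eq_avg => s; congr (nrm _ ^+ 2).
  rewrite [RHS](reindex_onto (@enum_rank I) enum_val) => [|k _]; last exact: enum_valK.
  apply: eq_big => [i|i _]; first by rewrite enum_rankK eqxx.
  by rewrite ffunE enum_rankK.
rewrite !reenum; apply: sqrt_le_sqr;
  try by rewrite rad_avgE; apply: avg_ge0 => ?; rewrite sqr_ge0.
by apply: (FK _ (fun k => T (enum_val k))) => k.
Qed.

(* The junk case [K < 0] only occurs for [X = 0] or [F = set0]. *)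
Lemma Rbounded_of_sqr (F : set (X -> X)) (K : R) :
  ((exists T, F T) -> forall x : X, 0 <= K * nrm x) ->
  (forall n (T : 'I_n -> X -> X) (x : 'I_n -> X), (exists T, F T) -> (forall k, F (T k)) ->
    avg (fun s : {ffun 'I_n -> bool} => nrm (\sum_k sg (s k) *: T k (x k)) ^+ 2) <=
    K ^+ 2 * avg (fun s : {ffun 'I_n -> bool} => nrm (\sum_k sg (s k) *: x k) ^+ 2)) ->
  Rbounded F K.
Proof.
move=> K0 FK n T x FT; rewrite !rad_avgE.
have [F0|F0] := pselect (exists T, F T); last first.
  case: n T x FT => [T x _|n T x FT]; last by case: F0; exists (T ord0).
  under eq_avg do rewrite big_ord0 nrm0 expr0n/=.
  under [X in _ <= _ * Num.sqrt X]eq_avg do rewrite big_ord0 nrm0 expr0n/=.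
  by rewrite avg_cst sqrtr0 mulr0.
have [K_ge0|K_lt0] := leP 0 K; first by apply: sqrt_le_of_sqr => //; apply: FK.
(* A negative [K] with [0 <= K * nrm y] forces [X] to be trivial, and both sides vanish. *)
have nrm_eq0 (y : X) : nrm y = 0.
  apply/eqP; rewrite eq_le nrm_ge0 andbT -(ler_nM2l K_lt0) mulr0.
  exact: K0.
under eq_avg do rewrite nrm_eq0 expr0n/=.
under [X in _ <= _ * Num.sqrt X]eq_avg do rewrite nrm_eq0 expr0n/=.
by rewrite avg_cst sqrtr0 mulr0.
Qed.

(** R-boundedness is tested on the single vector [x]. The factor [nrm x] stays because [K] may be
    negative when [X] is trivial. *)
Lemma Rbounded_nonneg (F : set (X -> X)) (K : R) (T : X -> X) (x : X) :
  F T -> Rbounded F K -> 0 <= K * nrm x.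
Proof.
move=> FT /(_ 1%N (fun _ => T) (fun _ => x) (fun _ => FT)) FK.
apply: (le_trans (sqrtr_ge0 _)); apply: (le_trans FK); rewrite rad_avgE.
under eq_avg do rewrite big_ord1 nrmZ [cabs _]cabs_sg mul1r.
by rewrite avg_cst sqrtr_sqr ger0_norm ?nrm_ge0.
Qed.

End Properties.

(** * The dual norm and adjoints *)

Section DualNorm.
Variables (R : realType) (X : normedModType R[i]).
Local Notation C := R[i].

Lemma dnorm_ubound (f : X -> C) : is_dual f ->
  has_sup [set cabs (f x) | x in [set x : X | nrm x <= 1]].
Proof.
move=> [_ [c fc]]; split; first by exists (cabs (f 0)), 0 => //=; rewrite nrm0 ler01.
exists `|c| => _ [x /= x1 <-]; apply: le_trans (fc x) _.
apply: le_trans (ler_wpM2r (nrm_ge0 x) (ler_norm c)) _.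
by rewrite -[leRHS]mulr1 ler_wpM2l.
Qed.

Lemma dnorm_ge0 (f : X -> C) : is_dual f -> 0 <= dnorm f.
Proof.
move=> fd; apply: le_trans (cabs_ge0 (f 0)) _.
by apply: (ub_le_sup (dnorm_ubound fd).2); exists 0 => //=; rewrite nrm0 ler01.
Qed.

(** By homogeneity it suffices to test the supremum at [x] divided by its norm; [x = 0] is treated
    apart. *)
Lemma cabs_le_dnorm (f : X -> C) x : is_dual f -> cabs (f x) <= dnorm f * nrm x.
Proof.
move=> fd; have [flin _] := fd.
have [x0|x_neq0] := eqVneq (nrm x) 0.
  have -> : x = 0 by apply/normr0_eq0; rewrite -nrmE x0.
  by rewrite (@lin0 _ _ C^o f flin) cabs0 nrm0 mulr0.
have x_gt0 : 0 < nrm x by rewrite lt_def x_neq0 nrm_ge0.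
rewrite -ler_pdivrMr// mulrC.
have xVE : cabs ((nrm x)^-1)%:C%C = (nrm x)^-1.
  by apply: (@complexI R); rewrite cabsE ger0_norm// lecR invr_ge0 nrm_ge0.
apply: (ub_le_sup (dnorm_ubound fd).2); exists (((nrm x)^-1)%:C%C *: x) => /=.
  by rewrite nrmZ xVE mulVf.
by rewrite (@linZ _ _ C^o f flin) cabsM xVE.
Qed.

(** The adjoint of [W] has norm at most that of [W]; it is applied to signed sums of the [U k]. *)
Lemma dnorm_comp_le (f : X -> C) (W : X -> X) (M : R) : is_dual f ->
  (forall x, nrm (W x) <= M * nrm x) -> dnorm (f \o W) <= `|M| * dnorm f.
Proof.
move=> fd WM; apply: ge_sup; first by exists (cabs (f (W 0))), 0 => //=; rewrite nrm0 ler01.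
move=> _ [x /= x1 <-]; apply: le_trans (cabs_le_dnorm _ fd) _.
rewrite mulrC ler_wpM2r ?dnorm_ge0//; apply: le_trans (WM x) _.
apply: le_trans (ler_wpM2r (nrm_ge0 x) (ler_norm M)) _.
by rewrite -[leRHS]mulr1 ler_wpM2l.
Qed.

Lemma is_dual_sum (I : finType) (a : I -> C) (f : I -> X -> C) :
  (forall i, is_dual (f i)) -> is_dual (fun x => \sum_i a i * f i x).
Proof.
move=> fd; split.
  move=> b x y; rewrite mulr_sumr -big_split; apply: eq_bigr => i _.
  by have [-> _] := fd i; rewrite /=; ring.
have /choice[c cP] : forall i, exists c : R, forall x, cabs (f i x) <= c * nrm x.
  by move=> i; have [_] := fd i.
exists (\sum_i cabs (a i) * c i) => x; apply: le_trans (cabs_sum _) _.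
rewrite mulr_suml; apply: ler_sum => i _.
by rewrite cabsM -mulrA ler_wpM2l ?cabs_ge0.
Qed.

Lemma is_dual_comp (f : X -> C) (W : X -> X) : is_dual f -> is_bop W -> is_dual (f \o W).
Proof.
move=> fd [Wlin [c Wc]]; have [flin _] := fd; split; first by move=> a x y; rewrite /= Wlin flin.
exists (dnorm f * c) => x; apply: le_trans (cabs_le_dnorm _ fd) _.
by rewrite -mulrA ler_wpM2l ?dnorm_ge0.
Qed.

End DualNorm.

(** * The R-bounds and WR-bounds for the operator families *)

Section OperatorFamilies.
Variables (R : realType) (X : normedModType R[i]).
Local Notation C := R[i].
Implicit Types (U V : nat -> X -> X) (F : set (X -> X)) (M Rc K : R).

Lemma sign_sum_boundedP U M n : sign_sum_bounded U M ->
  sign_bounded (fun k : 'I_n => U k) M.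
Proof. by move=> UM s x; apply: (UM n s x). Qed.

(** Vectors acted on by the same [U j] are grouped, since operators may repeat. Decoupling attaches
    a sign [t j] to each group, and these signs are absorbed into [s]. *)
Lemma range_Rbounded U M : (forall k, is_bop (U k)) -> sign_sum_bounded U M ->
  Rbounded (range U) M.
Proof.
move=> Ub UM; apply: Rbounded_of_sqr => [_ x|n T x _ FT].
  (* The empty signed sum already gives [0 <= M * nrm x]. *)
  have := UM 0%N [ffun _ => true] x; rewrite big_ord0 nrm0; exact.
have /choice[r rP] : forall k, exists j, U j = T k.
  by move=> k; have [j _ <-] := FT k; exists j.
pose N := (\max_k r k).+1.
have rN k : (r k < N)%N by rewrite ltnS leq_bigmax.
pose p k : 'I_N := Ordinal (rN k).
have Ulin (j : 'I_N) a x' y : U j (a *: x' + y) = a *: U j x' + U j y by have [] := Ub j.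
have step (s : {ffun 'I_n -> bool}) : nrm (\sum_k sg (s k) *: T k (x k)) ^+ 2 <=
    M ^+ 2 * avg (fun t : {ffun 'I_N -> bool} =>
      nrm (\sum_k sg (signM s [ffun k => t (p k)] k) *: x k) ^+ 2).
  have -> : \sum_k sg (s k) *: T k (x k) =
      \sum_(j < N) U j (\sum_(k | p k == j) sg (s k) *: x k).
    rewrite (partition_big p predT)//=; apply: eq_bigr => j _.
    rewrite (lin_sumZ (Ulin j)); apply: eq_bigr => k /eqP <-.
    by rewrite -rP.
  apply: le_trans (sign_bounded_decouple _ Ulin (sign_sum_boundedP UM)) _.
  rewrite le_eqVlt; apply: predU1l; congr (_ * _); apply: eq_avg => t; congr (nrm _ ^+ 2).
  rewrite (sum_fibre p (fun j => sg (t j))); apply: eq_bigr => k _.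
  by rewrite !ffunE sgM scalerA mulrC.
apply: le_trans (avg_le step) _.
rewrite avgZ avg_swap; under eq_avg => t do
  rewrite (avg_shift _ (fun s => nrm (\sum_k sg (s k) *: x k) ^+ 2)).
by rewrite avg_cst.
Qed.

(* Randomising with an independent sign matrix [w], which property (alpha) allows on
   both sides, replaces the products [s_i t_j] by independent signs [w_ij]. *)
Lemma Rbounded_alpha F Rc K (I J : finType) (T : I -> J -> X -> X) (y : I -> J -> X)
    (a : I -> J -> C) :
  (forall (I J : finType) (x : I -> J -> X) (a : I -> J -> C),
    (forall i j, cabs (a i j) <= 1) ->
    avg (fun s => avg (fun t =>
      nrm (\sum_i \sum_j (a i j * sg (s i) * sg (t j)) *: x i j) ^+ 2)) <=
    K ^+ 2 * avg (fun s => avg (fun t =>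
      nrm (\sum_i \sum_j (sg (s i) * sg (t j)) *: x i j) ^+ 2))) ->
  Rbounded F Rc -> (forall i j, F (T i j)) -> (forall i j, cabs (a i j) <= 1) ->
  avg (fun s => avg (fun t =>
    nrm (\sum_i \sum_j (a i j * sg (s i) * sg (t j)) *: T i j (y i j)) ^+ 2)) <=
  (K ^+ 2 * Rc) ^+ 2 * avg (fun s => avg (fun t =>
    nrm (\sum_i \sum_j (sg (s i) * sg (t j)) *: y i j) ^+ 2)).
Proof.
move=> HK FRc FT a1; set lhs := avg _; set rhs := avg _.
pose Z (z : I -> J -> X) (w : {ffun I * J -> bool}) :=
  nrm (\sum_i \sum_j sg (w (i, j)) *: z i j) ^+ 2.
pose Ty i j := T i j (y i j).
have mixed (z : I -> J -> X) :
  avg (fun w => avg (fun s => avg (fun t =>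
    nrm (\sum_i \sum_j (sg (s i) * sg (t j)) *: (sg (w (i, j)) *: z i j)) ^+ 2)))
  = avg (Z z).
  rewrite avg_swap; under eq_avg => s do rewrite avg_swap.
  rewrite -[RHS](avg_cst I); apply: eq_avg => s.
  rewrite -[RHS](avg_cst J); apply: eq_avg => t.
  (* For fixed [s] and [t] the products of their signs are absorbed into [w]. *)
  rewrite -(avg_shift [ffun p => s p.1 == t p.2] (Z z)).
  apply: eq_avg => w; congr (nrm _ ^+ 2).
  apply: eq_bigr => i _; apply: eq_bigr => j _.
  by rewrite !ffunE !sgM scalerA mulrC.
have Z_pair (z : I * J -> X) : forall w : {ffun I * J -> bool},
    Z (fun i j => z (i, j)) w = nrm (\sum_p sg (w p) *: z p) ^+ 2.
  by move=> w; rewrite /Z pair_bigA; congr (nrm _ ^+ 2); apply: eq_bigr => -[].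
have lhsZ : lhs <= K ^+ 2 * avg (Z Ty).
  rewrite -mixed -avgZ -[lhs](avg_cst (I * J)%type); apply: avg_le => w.
  (* For fixed [w], its signs are put into both the vectors and the coefficients; their squares are
     1, so the left side is unchanged. *)
  apply: le_trans (HK _ _ (fun i j => sg (w (i, j)) *: Ty i j) (fun i j => a i j * sg (w (i, j))) _).
    rewrite le_eqVlt; apply: predU1l; apply: eq_avg2 => s t; congr (nrm _ ^+ 2).
    apply: eq_bigr => i _; apply: eq_bigr => j _; rewrite scalerA; congr (_ *: _).
    by rewrite -[LHS]mul1r -(sg_sqr R (w (i, j))); ring.
  by move=> i j; rewrite cabsM cabs_sg mulr1.
have ZR : avg (Z Ty) <= Rc ^+ 2 * avg (Z y).
  have := Rbounded_fin (fun p => y p.1 p.2) FRc (fun p : I * J => FT p.1 p.2).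
  rewrite (eq_avg (Z_pair (fun p => Ty p.1 p.2))).
  by rewrite (eq_avg (Z_pair (fun p => y p.1 p.2))).
have Zrhs : avg (Z y) <= K ^+ 2 * rhs.
  rewrite -mixed -[K ^+ 2 * rhs](avg_cst (I * J)%type); apply: avg_le => w.
  (* Here the signs of [w] are themselves the coefficients to be removed. *)
  apply: le_trans (HK _ _ y (fun i j => sg (w (i, j))) _).
    rewrite le_eqVlt; apply: predU1l; apply: eq_avg2 => s t; congr (nrm _ ^+ 2).
    apply: eq_bigr => i _; apply: eq_bigr => j _; rewrite scalerA; congr (_ *: _).
    by ring.
  by move=> i j; rewrite cabs_sg.
apply: (le_trans lhsZ).
apply: (le_trans (ler_wpM2l (sqr_ge0 K) ZR)).
apply: (le_trans (ler_wpM2l (sqr_ge0 K) (ler_wpM2l (sqr_ge0 Rc) Zrhs))).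
by rewrite le_eqVlt; apply: predU1l; ring.
Qed.

(** Padding with zero coefficients lets finitely many members of the family be written with a common
    length. *)
Lemma fam_TUVP U V F S : fam_TUV U V F S ->
  exists N (a : nat -> C) (T : nat -> X -> X), [/\ forall k, cabs (a k) <= 1,
    forall k, F (T k) &
    forall m, (N <= m)%N -> forall x, S x = \sum_(k < m) a k *: T k (U k (V k x))].
Proof.
move=> [n [a [T [a1 [FT ->]]]]].
(* Beyond the end the coefficient is 0, while [inord] still yields an operator of [F]. *)
exists n.+1, (fun k => if (k < n.+1)%N then a (inord k) else 0), (fun k => T (inord k)).
split=> [k|k//|m nm x]; first by case: ifP => // _; rewrite cabs0 ler01.
rewrite (eq_bigr (fun k : 'I_n.+1 => a (inord k) *: T (inord k) (U k (V k x)))).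
  rewrite (big_ord_widen m (fun k => a (inord k) *: T (inord k) (U k (V k x))))//.
  rewrite big_mkcond; apply: eq_bigr => k _.
  by case: ifP => // _; rewrite scale0r.
by move=> k _; rewrite inord_val.
Qed.

Lemma fam_TUV_uniform U V F n (S : 'I_n -> X -> X) : (forall i, fam_TUV U V F (S i)) ->
  exists m (a : 'I_n -> 'I_m -> C) (T : 'I_n -> 'I_m -> X -> X),
    [/\ forall i k, cabs (a i k) <= 1, forall i k, F (T i k) &
    forall i x, S i x = \sum_(k < m) a i k *: T i k (U k (V k x))].
Proof.
move=> FS; have /choice[N] := fun i => fam_TUVP (FS i).
move=> /choice[a] /choice[T] H.
exists (\max_i N i), (fun i k => a i k), (fun i k => T i k).
split=> [i k|i k|i x]; have [h1 h2 h3] := H i => //.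
by apply: h3; rewrite leq_bigmax.
Qed.

Lemma fam_UVE U V : fam_UV U V = fam_TUV U V [set id].
Proof.
apply/seteqP; split=> [S [n [a [a1 ->]]]|S [n [a [T [a1 [Tid ->]]]]]].
  by exists n, a, (fun _ => id).
exists n, a; split => //; apply/funext => x.
by apply: eq_bigr => k _; rewrite Tid.
Qed.

Lemma fam_TUV_Rbounded : prop_alpha X -> exists K : R, forall U V M F Rc,
  thm33_hyps U V M F Rc -> Rbounded (fam_TUV U V F) (K * Rc * M ^+ 2).
Proof.
(* The constant is a square because [Rbounded_alpha] uses property (alpha) twice. *)
move=> /prop_alpha_rect[K HK]; exists (K ^+ 2) => U V M F Rc.
move=> [Ub [Vb [UM [VM [Fb [TU [TV FRc]]]]]]].
apply: Rbounded_of_sqr => [[S [n [a [T [_ [FT _]]]]]] x|n S x _ FS].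
  (* A member of the family has at least one term, so [F] contains an operator on which to test
     [Rc]. *)
  rewrite -mulrA -mulrA mulr_ge0 ?sqr_ge0// mulrCA mulr_ge0 ?sqr_ge0//.
  exact: (Rbounded_nonneg _ (FT ord0)).
have [m [a [T [a1 FT SE]]]] := fam_TUV_uniform FS.
have Ulin (j : 'I_m) b x' y : U j (b *: x' + y) = b *: U j x' + U j y by have [] := Ub j.
have Vlin (j : 'I_m) b x' y : V j (b *: x' + y) = b *: V j x' + V j y by have [] := Vb j.
have step (s : {ffun 'I_n -> bool}) : nrm (\sum_i sg (s i) *: S i (x i)) ^+ 2 <=
    M ^+ 2 * avg (fun t : {ffun 'I_m -> bool} =>
      nrm (\sum_i \sum_k (a i k * sg (s i) * sg (t k)) *: T i k (V k (x i))) ^+ 2).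
  (* Commutation of [T i k] with [U k] brings [U k] outermost, ready for decoupling. *)
  have -> : \sum_i sg (s i) *: S i (x i) =
      \sum_(k < m) U k (\sum_i (a i k * sg (s i)) *: T i k (V k (x i))).
    under [RHS]eq_bigr => k _ do rewrite (lin_sumZ (Ulin k)).
    rewrite exchange_big; apply: eq_bigr => i _; rewrite SE scaler_sumr.
    by apply: eq_bigr => k _; rewrite scalerA mulrC TU.
  apply: le_trans (sign_bounded_decouple _ Ulin (sign_sum_boundedP UM)) _.
  rewrite le_eqVlt; apply: predU1l; congr (_ * _); apply: eq_avg => t; congr (nrm _ ^+ 2).
  rewrite [RHS]exchange_big; apply: eq_bigr => k _; rewrite scaler_sumr.
  by apply: eq_bigr => i _; rewrite scalerA [in LHS]mulrC.
apply: le_trans (avg_le step) _; rewrite avgZ.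
apply: le_trans (ler_wpM2l (sqr_ge0 M) (Rbounded_alpha _ HK FRc FT a1)) _.
have -> : (K ^+ 2 * Rc * M ^+ 2) ^+ 2 = M ^+ 2 * ((K ^+ 2 * Rc) ^+ 2 * M ^+ 2) by ring.
rewrite -mulrA ler_wpM2l ?sqr_ge0// -mulrA ler_wpM2l ?sqr_ge0// -avgZ.
apply: avg_le => s; rewrite -[leRHS](avg_cst 'I_m); apply: avg_le => t.
rewrite (sum_sign_bounded _ _ _ Vlin).
exact: (sign_bounded_sqr _ _ (sign_sum_boundedP VM)).
Qed.

(** The identity commutes with everything and is R-bounded with constant 1; this reduces the family
    without operators [T] to the general one. *)
Lemma thm33_hyps_id U V M F Rc : thm33_hyps U V M F Rc -> thm33_hyps U V M [set id] 1.
Proof.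
move=> [Ub [Vb [UM [VM _]]]]; do 4!split => //.
split; first by move=> T ->; split=> //; exists 1 => x; rewrite mul1r.
split; first by move=> T ->.
split; first by move=> T ->.
by move=> n T x Tid; rewrite mul1r; have -> : T = fun _ => id by apply/funext => k; exact: Tid.
Qed.

(** In the pairing, [U k] is moved to the functional as its adjoint. Property (A) is applied to the
    vectors [V k (x i)] and the functionals [xs i \o U k], and each of the two random sums costs one
    factor [|M|]. *)
Lemma fam_UV_WRbounded : prop_A X -> exists K : R, forall U V M F Rc,
  thm33_hyps U V M F Rc -> WRbounded (fam_UV U V) (K * M ^+ 2).
Proof.
move=> /prop_A_rect[K K0 HK]; exists K => U V M F Rc.
move=> [Ub [Vb [UM [VM _]]]] n S x xs; rewrite fam_UVE => FS xsd.
have [m [a [T [a1 FT SE]]]] := fam_TUV_uniform FS.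
have Ulin (j : 'I_m) b x' y : U j (b *: x' + y) = b *: U j x' + U j y by have [] := Ub j.
have Vlin (j : 'I_m) b x' y : V j (b *: x' + y) = b *: V j x' + V j y by have [] := Vb j.
pose ys i (k : 'I_m) : X -> C := xs i \o U k.
have ysd i k : is_dual (ys i k) by apply: is_dual_comp.
apply: (@le_trans _ _ (\sum_i \sum_(k < m) cabs (ys i k (V k (x i))))).
  apply: ler_sum => i _; have [xslin _] := xsd i.
  rewrite SE (@lin_sumZ _ _ C^o (xs i) xslin); apply: le_trans (cabs_sum _) _.
  apply: ler_sum => k _; rewrite FT [_ *: _]/(_ * _) cabsM.
  by rewrite -[leRHS]mul1r ler_wpM2r ?cabs_ge0.
apply: le_trans (HK _ _ (fun i (k : 'I_m) => V k (x i)) ys ysd) _.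
have nrm_le : Num.sqrt (avg (fun s => avg (fun t =>
    nrm (\sum_i \sum_(k < m) (sg (s i) * sg (t k)) *: V k (x i)) ^+ 2))) <=
    `|M| * Num.sqrt (rad_avg (@nrm R X) (fun e => \sum_i e i *: x i)).
  rewrite rad_avgE; apply: sqrt_le_of_sqr; rewrite // real_normK ?num_real// -avgZ.
  apply: avg_le => s; rewrite -[leRHS](avg_cst 'I_m); apply: avg_le => t.
  rewrite (sum_sign_bounded _ _ _ Vlin).
  exact: (sign_bounded_sqr _ _ (sign_sum_boundedP VM)).
have dnorm_le : Num.sqrt (avg (fun s => avg (fun t =>
    dnorm (fun y => \sum_i \sum_(k < m) sg (s i) * sg (t k) * ys i k y) ^+ 2))) <=
    `|M| * Num.sqrt (rad_avg (@dnorm R X) (fun e y => \sum_i e i * xs i y)).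
  rewrite rad_avgE; apply: sqrt_le_of_sqr; rewrite // -avgZ.
  apply: avg_le => s; rewrite -[leRHS](avg_cst 'I_m); apply: avg_le => t.
  pose f y := \sum_i sgn R s i * xs i y.
  have fd : is_dual f by apply: is_dual_sum.
  pose W y := \sum_(k < m) sg (t k) *: U k y.
  (* The random sum of functionals is the adjoint of a signed sum of the [U k] applied to a signed
     sum of the [xs i]. *)
  have -> : (fun y => \sum_i \sum_(k < m) sg (s i) * sg (t k) * ys i k y) = f \o W.
    apply/funext => y; apply: eq_bigr => i _; have [xslin _] := xsd i.
    rewrite (@lin_sumZ _ _ C^o (xs i) xslin) mulr_sumr; apply: eq_bigr => k _.
    by rewrite -mulrA.
  (* Boundedness of [f \o W] makes its [dnorm] nonnegative, so that the norm inequality may be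
     squared. *)
  have fWd : is_dual (f \o W).
    split; last first.
      exists (dnorm f * M) => y; apply: le_trans (cabs_le_dnorm _ fd) _.
      by rewrite -mulrA ler_wpM2l ?dnorm_ge0//; apply: (UM m t).
    move=> b y z; have [flin _] := fd; rewrite /= -flin; congr f.
    rewrite /W scaler_sumr -big_split; apply: eq_bigr => k _.
    by rewrite Ulin scalerDr !scalerA mulrC.
  rewrite -exprMn lerXn2r ?nnegrE ?mulr_ge0 ?dnorm_ge0//.
  by apply: dnorm_comp_le => // y; apply: (UM m t).
have assoc (u v : R) : K * M ^+ 2 * u * v = K * (M ^+ 2 * (u * v)) by ring.
rewrite assoc -mulrA ler_wpM2l//.
apply: le_trans (ler_pM (sqrtr_ge0 _) (sqrtr_ge0 _) nrm_le dnorm_le) _.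
by rewrite mulrACA -expr2 real_normK ?num_real.
Qed.

(* The [x i] with the same [S i] are grouped; independent signs attached to
   the groups give the triangular double sum of property (Delta). *)
Lemma fam_sumUV_Rbounded : prop_Delta X -> exists K : R, forall U V M F Rc,
  thm33_hyps U V M F Rc -> Rbounded (fam_sumUV U V) (K * M ^+ 2).
Proof.
move=> /prop_Delta_sqr[K K0 HK]; exists K => U V M F Rc.
move=> [Ub [Vb [UM [VM _]]]]; apply: Rbounded_of_sqr => [_ x|n S x _ FS].
  by rewrite mulr_ge0 ?nrm_ge0// mulr_ge0 ?sqr_ge0.
have /choice[r rP] := FS.
pose N := (\max_k r k).+1.
have rN k : (r k < N)%N by rewrite ltnS leq_bigmax.
pose p k : 'I_N := Ordinal (rN k).
have Ulin (j : 'I_N) b x' y : U j (b *: x' + y) = b *: U j x' + U j y by have [] := Ub j.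
have Vlin (j : 'I_N) b x' y : V j (b *: x' + y) = b *: V j x' + V j y by have [] := Vb j.
pose y (s : {ffun 'I_n -> bool}) (j : 'I_N) := \sum_(i | p i == j) sg (s i) *: x i.
have SE i : S i (x i) = \sum_(k < N | (k <= p i)%N) U k (V k (x i)).
  by rewrite rP (big_ord_widen N (fun k => U k (V k (x i))))//.
have step (s : {ffun 'I_n -> bool}) : nrm (\sum_i sg (s i) *: S i (x i)) ^+ 2 <=
    M ^+ 2 * avg (fun t : {ffun 'I_N -> bool} =>
      nrm (\sum_(j < N) \sum_(k < N | (k <= j)%N) sg (t k) *: V k (y s j)) ^+ 2).
  (* Exchanging the sums, [U k] collects all groups [j] with [k <= j], since a member of group [j]
     is the partial sum up to and including [j]. *)
  have -> : \sum_i sg (s i) *: S i (x i) =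
      \sum_(k < N) U k (\sum_(j < N | (k <= j)%N) V k (y s j)).
    under [RHS]eq_bigr => k _ do rewrite (lin_sum (Ulin k)).
    rewrite (exchange_big_dep predT)//= (partition_big p predT)//=.
    apply: eq_bigr => j _.
    under [RHS]eq_bigr => k _ do rewrite (lin_sumZ (Vlin k)) (lin_sumZ (Ulin k)).
    rewrite exchange_big; apply: eq_bigr => i /eqP pij.
    by rewrite SE pij scaler_sumr.
  apply: le_trans (sign_bounded_decouple _ Ulin (sign_sum_boundedP UM)) _.
  rewrite le_eqVlt; apply: predU1l; congr (_ * _); apply: eq_avg => t; congr (nrm _ ^+ 2).
  rewrite [RHS](exchange_big_dep predT)//=; apply: eq_bigr => k _.
  by rewrite scaler_sumr.
apply: le_trans (avg_le step) _; rewrite avgZ.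
have -> : (K * M ^+ 2) ^+ 2 = M ^+ 2 * (K ^+ 2 * M ^+ 2) by ring.
rewrite -mulrA ler_wpM2l ?sqr_ge0//.
pose G (s : {ffun 'I_n -> bool}) := nrm (\sum_i sg (s i) *: x i) ^+ 2.
have y_shift s (d : {ffun 'I_N -> bool}) j :
    y (signM s [ffun i => d (p i)]) j = sg (d j) *: y s j.
  rewrite /y scaler_sumr; apply: eq_bigr => i /eqP <-.
  by rewrite !ffunE sgM scalerA mulrC.
(* Flipping all signs of group [j] by [d j] preserves the law of [s] and turns [y s j] into
   [sg (d j) *: y s j]. This creates the second independent family of signs. *)
rewrite -[leLHS](avg_cst 'I_N).
under eq_avg => d do rewrite -(avg_shift [ffun i => d (p i)]).
rewrite avg_swap.
have y_sum s (d : {ffun 'I_N -> bool}) : nrm (\sum_j sg (d j) *: y s j) ^+ 2 =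
    G (signM s [ffun i => d (p i)]).
  rewrite /G (partition_big p predT)//=; congr (nrm _ ^+ 2).
  by apply: eq_bigr => j _; rewrite -y_shift.
apply: (@le_trans _ _ (avg (fun s => K ^+ 2 * (M ^+ 2 *
    avg (fun d : {ffun 'I_N -> bool} => G (signM s [ffun i => d (p i)])))))).
  apply: avg_le => s.
  have -> : avg (fun d : {ffun 'I_N -> bool} => avg (fun t : {ffun 'I_N -> bool} =>
      nrm (\sum_(j < N) \sum_(k < N | (k <= j)%N)
        sg (t k) *: V k (y (signM s [ffun i => d (p i)]) j)) ^+ 2)) =
    avg (fun d => avg (fun t => nrm (\sum_(j < N) \sum_(k < N | (k <= j)%N)
        (sg (d j) * sg (t k)) *: V k (y s j)) ^+ 2)).
    apply: eq_avg2 => d t; congr (nrm _ ^+ 2).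
    apply: eq_bigr => j _; apply: eq_bigr => k _.
    by rewrite y_shift (linZ (Vlin k)) scalerA mulrC.
  (* Property (Delta) is applied for fixed [s], with [d] and [t] as the two sign sequences; the full
     double sum then factors through the [V k]. *)
  apply: le_trans (HK N (fun j k => V k (y s j))) _.
  rewrite ler_wpM2l ?sqr_ge0// -avgZ; apply: avg_le => d.
  rewrite -y_sum -[leRHS](avg_cst 'I_N); apply: avg_le => t.
  rewrite (sum_sign_bounded _ _ _ Vlin).
  exact: (sign_bounded_sqr _ _ (sign_sum_boundedP VM)).
(* For fixed [d] the group signs are absorbed back into [s]. *)
rewrite (avgZ (K ^+ 2)) (avgZ (M ^+ 2)) mulrA -exprMn ler_wpM2l ?sqr_ge0// avg_swap.
under eq_avg => d do rewrite (avg_shift _ G).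
by rewrite avg_cst.
Qed.

End OperatorFamilies.

Theorem theorem3p3 (R : realType) (X : completeNormedModType R[i]) :
  (* (1) *)
  (forall (U V : nat -> X -> X) (M : R) (F : set (X -> X)) (Rc : R),
     thm33_hyps U V M F Rc -> Rbounded (range U) M) /\
  (* (2) *)
  (prop_alpha X -> exists Cst : R,
     forall (U V : nat -> X -> X) (M : R) (F : set (X -> X)) (Rc : R),
       thm33_hyps U V M F Rc -> Rbounded (fam_TUV U V F) (Cst * Rc * M ^+ 2)) /\
  (prop_alpha X -> exists Cst : R,
     forall (U V : nat -> X -> X) (M : R) (F : set (X -> X)) (Rc : R),
       thm33_hyps U V M F Rc -> Rbounded (fam_UV U V) (Cst * M ^+ 2)) /\
  (* (3) *)
  (prop_A X -> exists Cst : R,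
     forall (U V : nat -> X -> X) (M : R) (F : set (X -> X)) (Rc : R),
       thm33_hyps U V M F Rc -> WRbounded (fam_UV U V) (Cst * M ^+ 2)) /\
  (* (4) *)
  (prop_Delta X -> exists Cst : R,
     forall (U V : nat -> X -> X) (M : R) (F : set (X -> X)) (Rc : R),
       thm33_hyps U V M F Rc -> Rbounded (fam_sumUV U V) (Cst * M ^+ 2)).
Proof.
split; first by move=> U V M F Rc [Ub [_ [UM _]]]; apply: range_Rbounded.
split; first exact: fam_TUV_Rbounded.
split.
  move=> /fam_TUV_Rbounded[K HK]; exists K => U V M F Rc /thm33_hyps_id/HK.
  by rewrite fam_UVE mulr1.
by split; [exact: fam_UV_WRbounded | exact: fam_sumUV_Rbounded].
Qed.
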